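(* Let $G$ be a topological group and $H$ a closed subgroup of $G$ such that the quotient space $G/H$ of left cosets is a $P_C$-space. (1) If $H$ and $G/H$ are weakly compact-bounded, then $G$ is weakly compact-bounded. (2) If $H$ and $G/H$ are compact-bounded, then $G$ is compact-bounded.
   Context: All topological spaces (in particular all topological groups) are assumed to be Hausdorff. For a closed subgroup $H$ of a topological group $G$ with natural quotient mapping $\pi:G\to G/H$, the space $G/H$ is called a $P_C$-space if for every compact subset $C$ of $G/H$ the inverse image $\pi^{-1}(C)$ is a compact subset of $G$. A space $X$ is compact-bounded if for every countable family $\mathcal U$ of non-empty open subsets of $X$ there is a compact $K\subset X$ which meets each element of $\mathcal U$. A space $X$ is weakly compact-bounded if for every infinite countable family $\mathcal U$ of non-empty open subsets of $X$ there is a compact $K\subset X$ which meets infinitely many elements of $\mathcal U$. *)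

(* Defs.v *)
From HB Require Import structures.
From mathcomp Require Import all_boot.
From mathcomp Require Import all_classical topology.

Set Implicit Arguments.
Unset Strict Implicit.
Unset Printing Implicit Defensive.

Local Open Scope classical_set_scope.

HB.mixin Record isTopologicalGroup G of Group G & Topological G := {
  mulg_continuous : continuous (fun x : G * G => (x.1 * x.2)%g) ;
  invg_continuous : continuous (fun x : G => x^-1%g)
}.

#[short(type="topologicalGroupType")]
HB.structure Definition TopologicalGroup :=
  {G of isTopologicalGroup G & Group G & Topological G}.

Section left_cosets.
Context {G : topologicalGroupType} (H : groupClosed G).

(* lcoset_rel x y iff x H = y H; a subgroup is a predicate bundled as a
   groupClosed structure, which makes lcoset_rel provably an equivalence. *)
Definition lcoset_rel : rel G := fun x y => (x^-1 * y)%g \in H.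

Lemma lcoset_rel_equiv : equiv_class_of lcoset_rel.
Proof.
rewrite /lcoset_rel; split=> [x|x y|y x z xy yz].
- by rewrite mulVg gpred1.
- by rewrite -gpredV invgM invgK.
- by rewrite -(mulgK y (x^-1)%g) -mulgA gpredM.
Qed.

Canonical lcoset_equiv_rel := EquivRelPack lcoset_rel_equiv.

Definition lcoset_space := quotient_topology {eq_quot lcoset_equiv_rel}%qT.

Definition lcoset_proj : G -> lcoset_space := \pi_lcoset_space%qT.

Definition PC_space := forall C : set lcoset_space,
  compact C -> compact (lcoset_proj @^-1` C).

End left_cosets.

(* A family is a set U of subsets of X, and countable sets may be finite. *)
Definition compact_bounded (X : topologicalType) :=
  forall U : set (set X), countable U ->
    (forall A, U A -> open A /\ A !=set0) ->
  exists2 K : set X, compact K & forall A, U A -> K `&` A !=set0.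

Definition weakly_compact_bounded (X : topologicalType) :=
  forall U : set (set X), countable U -> infinite_set U ->
    (forall A, U A -> open A /\ A !=set0) ->
  exists2 K : set X, compact K & infinite_set [set A | U A /\ K `&` A !=set0].

(* Main.v *)
(* The projection of G onto G/H is open, so open sets in G have open images. When
   G/H is a P_C-space, the preimage of a compact set K meeting such images is a
   compact set meeting the original sets. For weak compact-boundedness, infinitely
   many open sets may have only finitely many images; then finitely many points
   of G/H, one in each image, already give a compact set meeting all of them. *)
Require Import Defs.
From HB Require Import structures.
From mathcomp Require Import all_boot.
From mathcomp Require Import all_classical topology.


Set Implicit Arguments.
Unset Strict Implicit.
Unset Printing Implicit Defensive.

Local Open Scope classical_set_scope.

Section left_coset_projection.
Context {G : topologicalGroupType} (H : groupClosed G).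
Local Notation proj := (@lcoset_proj G H).

Lemma lcoset_projP (x y : G) : proj x = proj y <-> (x^-1 * y)%g \in H.
Proof. by split=> [/eqmodP//|?]; apply/eqmodP. Qed.

Lemma mulgr_continuous (h : G) : continuous (fun x : G => (x * h)%g).
Proof.
move=> x; apply: (@continuous_comp _ _ _ (fun x : G => (x, h))
  (fun y : G * G => (y.1 * y.2)%g)).
  by apply: cvg_pair; [exact: cvg_id|exact: cvg_cst].
exact: mulg_continuous.
Qed.

(** In the quotient topology, openness is tested on the saturation of [A]. This is the union over
    [h] in [H] of the translates of [A] by the inverse of [h], all open because right translations
    are continuous. *)
Lemma lcoset_proj_open (A : set G) : open A -> open (proj @` A).
Proof.
move=> oA; rewrite /open/= /quotient_open.
have -> : proj @^-1` (proj @` A) =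
    \bigcup_(h in [set` H]) ((fun x : G => (x * h)%g) @^-1` A).
  apply/seteqP; split=> [x [a Aa /esym/lcoset_projP xa]|x [h Hh Axh]].
    by exists (x^-1 * a)%g => //=; rewrite mulVKg.
  by exists (x * h)%g => //; apply/esym/lcoset_projP; rewrite mulKg.
apply: bigcup_open => h _; apply: open_comp => // x _.
exact: mulgr_continuous.
Qed.

Lemma meets_lcoset_proj (K : set (lcoset_space H)) (A : set G) :
  (proj @^-1` K) `&` A !=set0 <-> K `&` (proj @` A) !=set0.
Proof.
split=> [[a [Ka Aa]]|[b [Kb [a Aa ab]]]].
  by exists (proj a); split=> //; exists a.
by exists a; split=> //=; rewrite ab.
Qed.

Lemma open_nonempty_lcoset_proj (U : set (set G)) :
  (forall A, U A -> open A /\ A !=set0) ->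
  forall B, (image^~ proj @` U) B -> open B /\ B !=set0.
Proof.
move=> U0 _ [A UA <-]; have [oA [a Aa]] := U0 _ UA.
by split; [exact: lcoset_proj_open|exists (proj a), a].
Qed.

Lemma PC_compact_bounded :
  PC_space H -> compact_bounded (lcoset_space H) -> compact_bounded G.
Proof.
move=> PC cb U cU U0.
have [//||K cK KU] := cb (image^~ proj @` U).
- exact: card_le_trans (card_image_le _ _) cU.
- exact: open_nonempty_lcoset_proj.
exists (proj @^-1` K); first exact: PC.
by move=> A UA; apply/meets_lcoset_proj/KU; exists A.
Qed.

Lemma PC_weakly_compact_bounded :
  PC_space H -> weakly_compact_bounded (lcoset_space H) ->
  weakly_compact_bounded G.
Proof.
move=> PC wcb U cU iU U0; set V := image^~ proj @` U.
have V0 := open_nonempty_lcoset_proj U0.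
have [finV|infV] := pselect (finite_set V).
  (* [xget] picks a point in each member of [V]; these members are nonempty, so the default [proj 1]
     never stands in for a missing point. *)
  pose K := xget (proj 1%g) @` V.
  exists (proj @^-1` K).
    by apply/PC/finite_compact/finite_image.
  suff -> : [set A | U A /\ (proj @^-1` K) `&` A !=set0] = U by [].
  apply/seteqP; split=> [A []//|A UA]; split=> //.
  have VA : V (proj @` A) by exists A.
  apply/meets_lcoset_proj; exists (xget (proj 1%g) (proj @` A)).
  by split; [exists (proj @` A)|have [_ [b]] := V0 _ VA; exact: xgetI].
have [|K cK KV] := wcb V _ infV V0.
  exact: card_le_trans (card_image_le _ _) cU.
exists (proj @^-1` K); first exact: PC.
(* If the preimage of [K] met only finitely many members of [U], their images would be finite in
   number, yet every member of [V] that meets [K] is such an image. *)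
apply: contra_not KV => /(finite_image (image^~ proj)); apply: sub_finite_set.
by move=> _ [[A UA <-] KA]; exists A => //; split=> //; apply/meets_lcoset_proj.
Qed.

End left_coset_projection.

Theorem proposition4p6 (G : topologicalGroupType) (H : groupClosed G)
    (hausG : hausdorff_space G) (clH : closed [set` H]) (PC : PC_space H) :
  (weakly_compact_bounded (set_type [set` H]) ->
   weakly_compact_bounded (lcoset_space H) -> weakly_compact_bounded G) /\
  (compact_bounded (set_type [set` H]) ->
   compact_bounded (lcoset_space H) -> compact_bounded G).
Proof.
by split=> _; [exact: PC_weakly_compact_bounded|exact: PC_compact_bounded].
Qed.
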